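(* Let $X$ be a topological space. If the Alexandroff duplicate $A(X)$ is star-Menger (respectively, star-Hurewicz, star-Rothberger), then $X$ is also star-Menger (respectively, star-Hurewicz, star-Rothberger).
   Context: The Alexandroff duplicate of $X$ is $A(X)=X\times\{0,1\}$, where each point of $X\times\{1\}$ is isolated and a basic neighbourhood of $\langle x,0\rangle$ is a set of the form $(U\times\{0\})\cup((U\times\{1\})\setminus\{\langle x,1\rangle\})$ with $U$ a neighbourhood of $x$ in $X$. For a subset $A$ of a space $Z$ and a collection $\mathcal{P}$ of subsets of $Z$, $St(A,\mathcal{P})=\bigcup\{B\in\mathcal{P} : A\cap B\neq\emptyset\}$. An open cover of $Z$ is a $\gamma$-cover if it is infinite and each point of $Z$ fails to belong to at most finitely many of its members. A space $Z$ is: - star-Menger if for each sequence $(\mathcal{U}_n)_{n\in\mathbb{N}}$ of open covers of $Z$ there are finite $\mathcal{V}_n\subseteq\mathcal{U}_n$ such that $\bigcup_{n\in\mathbb{N}}\{St(V,\mathcal{U}_n) : V\in\mathcal{V}_n\}$ is an open cover of $Z$; - star-Hurewicz if for each sequence $(\mathcal{U}_n)_{n\in\mathbb{N}}$ of open covers of $Z$ there are finite $\mathcal{V}_n\subseteq\mathcal{U}_n$ such that either $\{St(\bigcup\mathcal{V}_n,\mathcal{U}_n) : n\in\mathbb{N}\}$ is a $\gamma$-cover of $Z$, or $St(\bigcup\mathcal{V}_n,\mathcal{U}_n)=Z$ for some $n$; - star-Rothberger if for each sequence $(\mathcal{U}_n)_{n\in\mathbb{N}}$ of open covers of $Z$ there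 are $V_n\in\mathcal{U}_n$ such that $\{St(V_n,\mathcal{U}_n) : n\in\mathbb{N}\}$ is an open cover of $Z$. *)

(* Defs.v *)
From HB Require Import structures.
From mathcomp Require Import all_boot all_classical topology.

Set Implicit Arguments.
Unset Strict Implicit.
Unset Printing Implicit Defensive.

Local Open Scope classical_set_scope.

(* An alias of [X * bool], so that it does not inherit the product topology.
   The point <x,0> is [(x, false)] and the point <x,1> is [(x, true)]. *)
Definition alexandroff_duplicate (X : Type) : Type := (X * bool)%type.

HB.instance Definition _ (X : choiceType) :=
  Choice.copy (alexandroff_duplicate X) (X * bool)%type.

Definition duplicate_basic (X : Type) (x : X) (U : set X) :
    set (alexandroff_duplicate X) :=
  (U `*` [set false]) `|` ((U `*` [set true]) `\` [set (x, true)]).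

(* W is open when it contains a basic neighbourhood of each of its points; the
   basic neighbourhood {<x,1>} of <x,1> imposes no condition.  For X a T1 space
   the basic sets form a neighbourhood base ([nbhs_duplicate0]).  Without T1
   they need not be a neighbourhood base for any topology (take X indiscrete
   with two points); in general this topology is coarser than every topology in
   which the <x,1> are isolated and the basic sets are neighbourhoods. *)
Definition duplicate_open (X : topologicalType) :
    set_system (alexandroff_duplicate X) :=
  [set W : set (alexandroff_duplicate X) | forall x : X, W (x, false) ->
    exists2 U, nbhs x U & duplicate_basic x U `<=` W].

Section duplicate_topology.
Variable X : topologicalType.

Let duplicate_openT : duplicate_open [set: alexandroff_duplicate X].
Proof. by move=> x _; exists setT; first exact: filterT. Qed.

Let duplicate_openI (A B : set (alexandroff_duplicate X)) :
  duplicate_open A -> duplicate_open B -> duplicate_open (A `&` B).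
Proof.
move=> oA oB x [/oA[U nU UA] /oB[V nV VB]].
exists (U `&` V); first exact: filterI.
by move=> [y b] [[[Uy Vy] yb]|[[[Uy Vy] yb] ne]];
  (split; [apply: UA|apply: VB]); by [left|right].
Qed.

Let duplicate_open_bigU (I : Type) (f : I -> set (alexandroff_duplicate X)) :
  (forall i, duplicate_open (f i)) -> duplicate_open (\bigcup_i f i).
Proof.
move=> of_ x [i _ /of_[U nU Uf]]; exists U => // p /Uf fp.
by exists i.
Qed.

HB.instance Definition _ := isOpenTopological.Build (alexandroff_duplicate X)
  duplicate_openT duplicate_openI duplicate_open_bigU.

Lemma open_duplicateE :
  (@open (alexandroff_duplicate X)) = @duplicate_open X.
Proof. by []. Qed.

Lemma nbhs_duplicate1 (x : X) :
  nbhs ((x, true) : alexandroff_duplicate X) = principal_filter (x, true).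
Proof.
apply/seteqP; split => A; first by move=> /nbhs_singleton/principal_filterP.
move=> /principal_filterP Ax; rewrite nbhsE; exists [set (x, true)].
  by split => // y [].
by move=> _ ->.
Qed.

Lemma nbhs_duplicate0 (x : X) : accessible_space X ->
  nbhs ((x, false) : alexandroff_duplicate X) =
  filter_from (nbhs x) (duplicate_basic x).
Proof.
move=> T1; apply/seteqP; split => A.
  rewrite (nbhsE ((x, false) : alexandroff_duplicate X)) => -[W [oW Wx] WA].
  have [U nU UW] := oW _ Wx.
  exists U; first exact: nU.
  by move=> p /UW /WA.
move=> [U nU UA]; rewrite (nbhsE ((x, false) : alexandroff_duplicate X)).
exists (duplicate_basic x U°); last first.
  move=> [y b] h; apply: UA; case: h => [[Uy yb]|[[Uy yb] ne]];
    [left|right]; by [split => //; exact: interior_subset Uy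
     |split => //; split => //; exact: interior_subset Uy].
split; last by left; split => //; exact/nbhs_singleton/nbhs_interior.
move=> y [[/= Uy _]|[[_ //]]].
have oU : open U° by exact: open_interior.
have [->|yx] := pselect (y = x).
  by exists U° => //; exact: nbhs_interior.
exists (U° `&` ~` [set x]).
  apply: filterI; first exact: open_nbhs_nbhs.
  apply: open_nbhs_nbhs; split => //.
  by rewrite openC; exact: accessible_closed_set1.
move=> [z b] [[[/= Uz zx] zb]|[[[/= Uz zx] zb] ne]]; first by left.
by right; split => // -[].
Qed.

End duplicate_topology.

Definition star (Z : Type) (A : set Z) (P : set (set Z)) : set Z :=
  \bigcup_(B in [set B | P B /\ A `&` B !=set0]) B.

Definition open_cover (Z : topologicalType) (P : set (set Z)) : Prop :=
  (forall B, P B -> open B) /\ \bigcup_(B in P) B = [set: Z].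

Definition gamma_cover (Z : topologicalType) (P : set (set Z)) : Prop :=
  [/\ open_cover P, infinite_set P &
      forall z, finite_set [set B | P B /\ ~ B z]].

Definition star_Menger (Z : topologicalType) : Prop :=
  forall U : nat -> set (set Z), (forall n, open_cover (U n)) ->
  exists V : nat -> set (set Z),
    (forall n, finite_set (V n) /\ V n `<=` U n) /\
    open_cover (\bigcup_n [set star B (U n) | B in V n]).

Definition star_Hurewicz (Z : topologicalType) : Prop :=
  forall U : nat -> set (set Z), (forall n, open_cover (U n)) ->
  exists V : nat -> set (set Z),
    (forall n, finite_set (V n) /\ V n `<=` U n) /\
    (gamma_cover [set star (\bigcup_(B in V n) B) (U n) | n in [set: nat]] \/
     exists n, star (\bigcup_(B in V n) B) (U n) = [set: Z]).

Definition star_Rothberger (Z : topologicalType) : Prop :=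
  forall U : nat -> set (set Z), (forall n, open_cover (U n)) ->
  exists V : nat -> set Z,
    (forall n, U n (V n)) /\
    open_cover [set star (V n) (U n) | n in [set: nat]].

(* Main.v *)
(** The projection of the Alexandroff duplicate of X onto X is a continuous
    surjection p, and each of the three star selection principles passes to
    continuous surjective images: pull the covers back along p, and note that
    taking preimages under p is injective on sets and commutes with stars. *)
Require Import Defs.
From mathcomp Require Import all_boot all_classical topology.

Set Implicit Arguments.
Unset Strict Implicit.
Unset Printing Implicit Defensive.

Local Open Scope classical_set_scope.

Lemma star_open (Z : topologicalType) (A : set Z) (P : set (set Z)) :
  (forall B, P B -> open B) -> open (star A P).
Proof. by move=> oP; apply: bigcup_open => B [/oP]. Qed.

Section surjection.
Variables (Y X : Type) (p : Y -> X).
Hypothesis p_surj : range p = [set: X].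

Lemma preimage_surj_inj : injective (preimage p).
Proof. by move=> A B /(congr1 (fun C => p @` C)); rewrite !image_preimage. Qed.

(** Surjectivity matters for the inclusion from right to left: a common point of [A] and [B] must
    lift to [Y] for their preimages to meet. *)
Lemma star_preimage (A : set X) (P : set (set X)) :
  star (p @^-1` A) (preimage p @` P) = p @^-1` (star A P).
Proof.
apply/seteqP; split=> y.
  by move=> [_ [[B PB <-] [z [Az Bz]]] By]; exists B => //; split=> //; exists (p z).
move=> [B [PB [x [Ax Bx]]] By]; exists (p @^-1` B) => //; split; first by exists B.
have [z _ zx] : range p x by rewrite p_surj.
by exists z; rewrite /= zx.
Qed.

Lemma sub_preimages (U : set (set X)) (V : set (set Y)) :
  V `<=` preimage p @` U -> exists2 V', V' `<=` U & V = preimage p @` V'.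
Proof.
(* Taking every member of [U] whose preimage lies in [V] avoids choosing one for each set of [V]. *)
move=> VU; exists (U `&` [set B | V (p @^-1` B)]); first by move=> B [].
apply/seteqP; split=> [A VA|_ [B [_ VB] <-] //].
by have [B UB BA] := VU _ VA; exists B; rewrite //= BA.
Qed.

Lemma finite_preimages (V : set (set X)) :
  finite_set (preimage p @` V) -> finite_set V.
Proof.
move=> /(finite_image (fun A => p @` A)); rewrite image_comp.
under eq_imagel do rewrite /= image_preimage//.
by rewrite image_id.
Qed.

(** Brings a selection made in [Y] down to [X]. The equation is between whole sequences, so that [V]
    can be substituted away. *)
Lemma finite_sub_preimages (I : Type) (U : I -> set (set X))
    (V : I -> set (set Y)) :
  (forall i, finite_set (V i) /\ V i `<=` preimage p @` U i) ->
  exists2 V', (forall i, finite_set (V' i) /\ V' i `<=` U i) &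
              V = fun i => preimage p @` V' i.
Proof.
move=> VU; have /choice[V' V'P] i : exists V', V' `<=` U i /\ V i = preimage p @` V'.
  by have [_ /sub_preimages[V' ? ?]] := VU i; exists V'.
exists V' => [i|]; last by apply/funext => i; have [] := V'P i.
have [V'U VE] := V'P i; split=> //.
by apply: finite_preimages; rewrite -VE; have [] := VU i.
Qed.

Lemma preimages_bigcup (P : set (set X)) :
  \bigcup_(B in preimage p @` P) B = p @^-1` (\bigcup_(B in P) B).
Proof. by rewrite bigcup_image preimage_bigcup. Qed.

End surjection.

Section continuous_surjection.
Variables (Y X : topologicalType) (p : Y -> X).
Hypotheses (p_cont : continuous p) (p_surj : range p = [set: X]).

Lemma open_cover_preimages (P : set (set X)) :
  open_cover P -> open_cover (preimage p @` P).
Proof.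
move=> [oP cP]; split; last by rewrite preimages_bigcup cP.
by move=> _ [B /oP oB <-]; apply: open_comp => // x _; exact: p_cont.
Qed.

(** Only the covering property descends along [p]: a set with open preimage need not be open, so
    openness is assumed. In the applications the members of [P] are stars, and [star_open] supplies
    it. *)
Lemma open_cover_of_preimages (P : set (set X)) :
  (forall B, P B -> open B) -> open_cover (preimage p @` P) -> open_cover P.
Proof.
move=> oP [_]; rewrite preimages_bigcup => cP; split=> //.
by apply: (preimage_surj_inj p_surj); rewrite cP.
Qed.

Lemma gamma_cover_of_preimages (P : set (set X)) :
  (forall B, P B -> open B) -> gamma_cover (preimage p @` P) -> gamma_cover P.
Proof.
move=> oP [cP iP fP]; split; first exact: open_cover_of_preimages.
  by move=> finP; apply: iP; exact: finite_image.
(* Any [y] over [x] will do: a member of [P] misses [x] exactly when its preimage misses [y]. *)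
move=> x; have [y _ <-] : range p x by rewrite p_surj.
apply/(finite_preimages p_surj)/(sub_finite_set _ (fP y)).
by move=> _ [B [PB nBy] <-]; split=> //; exists B.
Qed.

Lemma star_Menger_surj : star_Menger Y -> star_Menger X.
Proof.
move=> mY U oU.
have [V [/(finite_sub_preimages p_surj)[V' V'U ->]]] :=
  mY _ (fun n => open_cover_preimages (oU n)).
have starE n :
    [set star B (preimage p @` U n) | B in preimage p @` V' n] =
    preimage p @` [set star B (U n) | B in V' n].
  by rewrite !image_comp; apply: eq_imagel => B _; exact: star_preimage.
move=> cV; exists V'; split=> //; apply: open_cover_of_preimages.
  by move=> _ [n _ [B _ <-]]; apply: star_open; have [] := oU n.
by rewrite image_bigcup; under eq_bigcupr do rewrite -starE.
Qed.

Lemma star_Hurewicz_surj : star_Hurewicz Y -> star_Hurewicz X.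
Proof.
move=> hY U oU.
have [V [/(finite_sub_preimages p_surj)[V' V'U ->]]] :=
  hY _ (fun n => open_cover_preimages (oU n)).
have starE n : star (\bigcup_(B in preimage p @` V' n) B) (preimage p @` U n) =
    p @^-1` star (\bigcup_(B in V' n) B) (U n).
  by rewrite preimages_bigcup star_preimage.
move=> cV; exists V'; split=> //; case: cV => [cV|[n sT]]; [left|right].
  apply: gamma_cover_of_preimages.
    by move=> _ [n _ <-]; apply: star_open; have [] := oU n.
  by rewrite image_comp; under eq_imagel do rewrite /= -starE.
by exists n; apply: (preimage_surj_inj p_surj); rewrite -starE.
Qed.

Lemma star_Rothberger_surj : star_Rothberger Y -> star_Rothberger X.
Proof.
move=> rY U oU.
have [V [VU cV]] := rY _ (fun n => open_cover_preimages (oU n)).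
(* Here a single set is selected for each [n], so choosing a preimage representation of each [V n]
   suffices. *)
have /choice[V' V'P] n : exists B, U n B /\ p @^-1` B = V n.
  by have [B ? ?] := VU n; exists B.
exists V'; split=> [n|]; first by have [] := V'P n.
apply: open_cover_of_preimages.
  by move=> _ [n _ <-]; apply: star_open; have [] := oU n.
rewrite image_comp; under eq_imagel => n _ do
  rewrite /= -star_preimage// (proj2 (V'P n)).
exact: cV.
Qed.

End continuous_surjection.

Definition duplicate_proj (X : Type) : alexandroff_duplicate X -> X := fst.

(** Openness in the duplicate is tested only at the points [(x, false)]. There [B] serves as its own
    neighbourhood, since both levels of [duplicate_basic x B] lie over [B]. *)
Lemma duplicate_proj_continuous (X : topologicalType) :
  continuous (@duplicate_proj X).
Proof.
apply/continuousP => B oB; rewrite open_duplicateE => x Bx.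
exists B; first exact: open_nbhs_nbhs.
by move=> [y b] [[By _]|[[By _] _]].
Qed.

Lemma duplicate_proj_surj (X : Type) : range (@duplicate_proj X) = [set: X].
Proof. by apply/seteqP; split=> // x _; exists (x, false). Qed.

Theorem theorem3p22 (X : topologicalType) :
  (star_Menger (alexandroff_duplicate X) -> star_Menger X) /\
  (star_Hurewicz (alexandroff_duplicate X) -> star_Hurewicz X) /\
  (star_Rothberger (alexandroff_duplicate X) -> star_Rothberger X).
Proof.
have pc := @duplicate_proj_continuous X; have ps := @duplicate_proj_surj X.
split; first exact: star_Menger_surj pc ps.
by split; [exact: star_Hurewicz_surj pc ps|exact: star_Rothberger_surj pc ps].
Qed.
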